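(* Let $\ell>0$, $V>0$ and $\rho_-,\rho_+$ be given with $$0\le \rho_-\le \rho^*\le \rho_+\le 1,\qquad f(\rho_-)=f(\rho_+).$$ Then the monotone stationary profile $W:\mathbb{R}\to[0,1]$ satisfying the delay differential equation $$W'(x)=\frac{W^2(x)}{\ell\,\phi(W(x))}\left[\phi(W(x))-\phi\!\left(W\!\left(x+\frac{\ell}{W(x)}\right)\right)\right]$$ and the boundary values $$\lim_{x\to-\infty}W(x)=\rho_-,\qquad \lim_{x\to+\infty}W(x)=\rho_+$$ is unique up to a horizontal shift; that is, if $W$ and $\bar W$ are two such profiles, then there is $h\in\mathbb{R}$ with $\bar W(x)=W(x-h)$ for all $x\in\mathbb{R}$.
   Context: Standing assumptions. $\ell>0$ is the car length and $V>0$ the speed limit. The function $\phi:[0,1]\to\mathbb{R}$ is twice continuously differentiable with $\phi(0)=1$, $\phi(1)=0$, and $\phi'(\rho)\le-\hat c_0<0$ for all $\rho\in[0,1]$, for some constant $\hat c_0>0$. The flux is $f(\rho)=V\rho\,\phi(\rho)$; it satisfies $f(0)=f(1)=0$, $f''(\rho)\le -c_0<0$ on $[0,1]$ for some constant $c_0>0$, and $\rho^*\in(0,1)$ is the unique point with $f'(\rho^* )=0$. Convention in the delay differential equation: if $W(x)=0$ for some $x$, then $W(x+\ell/W(x))$ is understood as $W(+\infty):=\lim_{y\to+\infty}W(y)$. In the degenerate case $\rho_-=0$, $\rho_+=1$, the profile is understood to be a step function equal to $0$ to the left and to $1$ to the right of some point $\hat x$ (the value at the jump point being immaterial). A stationary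 profile is a function $W$ satisfying this delay differential equation. *)

(* Defs.v *)
From Stdlib Require Import Reals.
From Coquelicot Require Import Coquelicot.
Open Scope R_scope.

Definition I01 (r : R) : Prop := 0 <= r <= 1.

(* The difference quotients only use points of D, so the derivative is
   one-sided at the endpoints of an interval and values outside D are
   irrelevant. *)
Definition derivative_on (D : R -> Prop) (f df : R -> R) : Prop :=
  forall x : R, D x -> D_in f df D x.

Definition flux (V : R) (phi : R -> R) (rho : R) : R := V * rho * phi rho.

(* W (x + l / W x), read as the limit of W at +oo where W x = 0. *)
Definition W_ahead (l : R) (W : R -> R) (x : R) : R :=
  if Req_EM_T (W x) 0 then real (Lim W p_infty) else W (x + l / W x).

Definition solves_DDE (l : R) (phi : R -> R) (W : R -> R) : Prop :=
  forall x : R,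
    derivable_pt_lim W x
      ((W x) ^ 2 / (l * phi (W x)) * (phi (W x) - phi (W_ahead l W x))).

(* The value at the jump point xhat is left free. *)
Definition step_at (xhat : R) (W : R -> R) : Prop :=
  (forall x : R, x < xhat -> W x = 0) /\ (forall x : R, xhat < x -> W x = 1).

Definition degenerate (rho_m rho_p : R) : Prop := rho_m = 0 /\ rho_p = 1.

(* In the degenerate case the right-hand side of the equation is 0/0 where
   W = 1, and "profile" means a unit step by convention. *)
Record monotone_stationary_profile
    (l : R) (phi : R -> R) (rho_m rho_p : R) (W : R -> R) : Prop := {
  profile_range : forall x : R, I01 (W x);
  profile_monotone : increasing W \/ decreasing W;
  profile_DDE : ~ degenerate rho_m rho_p -> solves_DDE l phi W;
  profile_step : degenerate rho_m rho_p -> exists xhat : R, step_at xhat W;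
  profile_lim_m : is_lim W m_infty rho_m;
  profile_lim_p : is_lim W p_infty rho_p
}.

(* Main.v *)
Require Import Defs.
From Stdlib Require Import Reals Lra Classical ClassicalEpsilon.
From Coquelicot Require Import Coquelicot.
Open Scope R_scope.

(** Unless the profile is a unit step or a constant, its end states satisfy
    0 < rho_m < rho_star < rho_p < 1, and the equation says that the travel
    time, the integral of 1 / phi (W z) over z from x to x + l / W x, does not
    depend on x: every car takes equally long to reach the present position
    of its leader.  Letting x tend to +infinity, its value is
    l / (rho_p * phi rho_p) for every profile ([travel_value]).

    A profile is strictly increasing, so for two of them there is a
    displacement D with Wbar (x + D x) = W x, and uniqueness up to a shift
    means that D is constant.  Over the headway interval from x to
    x + L, with L = l / W x, the two travel times agree; shifting the second
    by D x gives

      integral over z from x to x + L of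
        1 / phi (W z) - 1 / phi (Wbar (z + D x))  =  0,

    where W z = Wbar (z + D z).  The integrand is therefore
    k x z * (D z - D x) with a positive kernel k: the value D x is a weighted
    mean of the values of D ahead of x ([displacement_balance]).

    The kernel is uniformly nondegenerate.  With u = rho_p - W, the equation
    gives W' <= C * u, and the constant travel time together with the strict
    concavity of the flux gives W' >= k * u as long as W stays away from
    rho_m.  On a headway interval u varies by a bounded factor only, so
    k x z lies between two multiples of u x whose ratio does not depend on x
    ([displacement_kernel_bounds]).  The same bounds show that D has bounded
    oscillation on windows of fixed length, without any precise asymptotics
    of the profiles ([displacement_oscillation_bounded]).

    It remains to see that such a D is constant ([forward_mean_liouville]).
    By the maximum principle the range of D on a window is contained in its
    range on each later window; because of the lower bound on the kernel, the
    oscillation on a window is at most theta < 1 times the oscillation on a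
    window further ahead.  Iterating n times, it is at most theta ^ n times a
    fixed bound for every n, hence zero. *)

(** * Calculus preliminaries *)

Lemma ex_RInt_everywhere_continuous (f : R -> R) (a b : R) :
  (forall x, continuous f x) -> ex_RInt f a b.
Proof.
  intros Hf; apply (ex_RInt_continuous (V := R_CompleteNormedModule)); intros; apply Hf.
Qed.

Lemma RInt_ge_const (f : R -> R) (a b m : R) :
  (forall x, continuous f x) -> a <= b ->
  (forall x, a <= x <= b -> m <= f x) -> (b - a) * m <= RInt f a b.
Proof.
  intros Hf Hab Hm.
  assert (Hc : RInt (fun _ => m) a b = (b - a) * m) by exact (RInt_const a b m).
  rewrite <- Hc.
  apply RInt_le; try assumption.
  - apply ex_RInt_const.
  - now apply ex_RInt_everywhere_continuous.
  - intros x Hx; apply Hm; lra.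
Qed.

Lemma RInt_subinterval_le (f : R -> R) (a c d b : R) :
  (forall x, continuous f x) -> a <= c -> c <= d -> d <= b ->
  (forall x, a <= x <= b -> 0 <= f x) -> RInt f c d <= RInt f a b.
Proof.
  intros Hf Hac Hcd Hdb Hpos.
  assert (E : forall u v, ex_RInt f u v)
    by (intros; now apply ex_RInt_everywhere_continuous).
  rewrite <- (RInt_Chasles f a c b), <- (RInt_Chasles f c d b) by apply E.
  assert (0 <= RInt f a c)
    by (apply RInt_ge_0; [assumption | apply E | intros; apply Hpos; lra]).
  assert (0 <= RInt f d b)
    by (apply RInt_ge_0; [assumption | apply E | intros; apply Hpos; lra]).
  unfold plus; simpl; lra.
Qed.

Lemma continuous_continuity_pt (f : R -> R) (x : R) :
  continuous f x -> continuity_pt f x.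
Proof. intros H; now apply continuity_pt_filterlim. Qed.

Lemma continuous_min (f : R -> R) (a b : R) :
  (forall x, continuous f x) -> a <= b ->
  exists q, a <= q <= b /\ forall x, a <= x <= b -> f q <= f x.
Proof.
  intros Hf Hab.
  destruct (continuity_ab_min f a b Hab) as [q [Hq Hq']].
  - intros c _; apply continuous_continuity_pt, Hf.
  - exists q; split; assumption.
Qed.

Lemma continuous_sub_const (D : R -> R) (m : R) :
  (forall x, continuous D x) -> forall x, continuous (fun z => D z - m) x.
Proof.
  intros HD x; apply (continuous_minus (V := R_NormedModule)).
  - apply HD.
  - apply continuous_const.
Qed.

Lemma continuous_opp_fun (D : R -> R) :
  (forall x, continuous D x) -> forall x, continuous (fun z => - D z) x.
Proof. intros HD x; apply (continuous_opp (V := R_NormedModule)), HD. Qed.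

Lemma continuous_eps_delta (f : R -> R) (x : R) :
  (forall eps, 0 < eps -> exists delta, 0 < delta /\
     forall y, Rabs (y - x) < delta -> Rabs (f y - f x) < eps) ->
  continuous f x.
Proof.
  intros H; apply continuity_pt_filterlim.
  intros eps Heps; destruct (H eps Heps) as [d [Hd Hy]].
  exists d; split; [assumption|].
  intros y [_ Hyx]; apply Hy, Hyx.
Qed.

Lemma eps_delta_continuous (f : R -> R) (x eps : R) :
  continuous f x -> 0 < eps ->
  exists delta, 0 < delta /\
    forall y, Rabs (y - x) < delta -> Rabs (f y - f x) < eps.
Proof.
  intros H Heps; apply continuity_pt_filterlim in H.
  destruct (H eps Heps) as [d [Hd Hy]].
  exists d; split; [assumption|].
  intros y Hyx.
  destruct (Req_dec y x) as [->|Hne].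
  - replace (f x - f x) with 0 by ring; now rewrite Rabs_R0.
  - apply Hy; split; [split; [exact I | congruence] | exact Hyx].
Qed.

Lemma mean_value (f df : R -> R) (s t : R) :
  (forall x, is_derive f x (df x)) -> s <= t ->
  exists xi, s <= xi <= t /\ f t - f s = df xi * (t - s).
Proof.
  intros Hf Hst.
  destruct (MVT_gen f s t df) as [xi [Hxi E]].
  - intros; apply Hf.
  - intros x _; apply continuous_continuity_pt, (ex_derive_continuous f).
    now exists (df x).
  - rewrite Rmin_left, Rmax_right in Hxi by assumption.
    now exists xi.
Qed.

Lemma exp_le_compat (x y : R) : x <= y -> exp x <= exp y.
Proof.
  intros [H | ->]; [left; now apply exp_increasing | apply Rle_refl].
Qed.

(** * A Liouville theorem for forward averages *)

Section ForwardMean.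

Variables (x0 h S eps : R).
Hypotheses (h_pos : 0 < h) (h_S : 2 * h <= S) (eps_pos : 0 < eps).

(** A one-sided Harnack-type condition: where [D >= m] on the window ahead of
    [x], the excess [D x - m] controls the mean excess on an initial part of
    that window.  Only the functions [D] for which both [D] and [- D] satisfy
    it behave like forward averages; keeping the two sides apart lets each
    argument below be made once and applied to [D] and to [- D]. *)
Definition dominates_forward_mean (D : R -> R) : Prop :=
  forall x m, x0 <= x -> (forall z, x <= z <= x + S -> m <= D z) ->
    eps * RInt (fun z => D z - m) x (x + 2 * h) <= D x - m.

(** A minimum attained at a point [q] left of [y] forces the forward mean of
    [D - D q] to vanish, and the interval [q, q + 2 h] of this mean contains
    [y, y + h], where [D] is at least [m]. *)
Lemma lower_bound_propagates_short (D : R -> R) :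
  (forall x, continuous D x) -> dominates_forward_mean D ->
  forall y m, (forall z, y <= z <= y + S -> m <= D z) ->
  forall p, x0 <= p -> y - h <= p -> p <= y + S -> m <= D p.
Proof.
  intros HD Hh y m Hm p Hp0 Hp Hpy.
  destruct (continuous_min D p (y + S) HD Hpy) as [q [Hq Hmin]].
  apply Rle_trans with (D q); [|apply Hmin; lra].
  destruct (Rle_dec y q) as [Hyq|Hyq]; [apply Hm; lra|].
  assert (H1 := Hh q (D q) ltac:(lra) ltac:(intros; apply Hmin; lra)).
  assert (Hc := continuous_sub_const D (D q) HD).
  assert (H2 : RInt (fun z => D z - D q) y (y + h)
               <= RInt (fun z => D z - D q) q (q + 2 * h)).
  { apply RInt_subinterval_le; try assumption; try lra.
    intros x Hx; assert (D q <= D x) by (apply Hmin; lra); lra. }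
  assert (H3 : (y + h - y) * (m - D q) <= RInt (fun z => D z - D q) y (y + h)).
  { apply RInt_ge_const; [assumption | lra |].
    intros x Hx; assert (m <= D x) by (apply Hm; lra); lra. }
  destruct (Rle_dec m (D q)) as [|Hn]; [assumption|exfalso].
  assert (0 < h * (m - D q)) by (apply Rmult_lt_0_compat; lra).
  assert (0 < eps * RInt (fun z => D z - D q) q (q + 2 * h))
    by (apply Rmult_lt_0_compat; lra).
  lra.
Qed.

(** The minimum principle: repeat the previous step in strides of length
    [h]. *)
Lemma lower_bound_propagates (D : R -> R) :
  (forall x, continuous D x) -> dominates_forward_mean D ->
  forall y m, (forall z, y <= z <= y + S -> m <= D z) ->
  forall p, x0 <= p <= y + S -> m <= D p.
Proof.
  intros HD Hh.
  assert (K : forall n y m, (forall z, y <= z <= y + S -> m <= D z) ->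
    forall p, x0 <= p -> y - INR n * h <= p -> p <= y + S -> m <= D p).
  { induction n as [|n IH]; intros y m Hm p Hp0 Hp Hpy.
    - simpl in Hp; apply Hm; lra.
    - rewrite S_INR in Hp.
      destruct (Rle_dec (y - h) p) as [H1|H1].
      + now apply (lower_bound_propagates_short D HD Hh y).
      + destruct (Rle_dec x0 (y - h)) as [H2|H2]; [|lra].
        apply (IH (y - h) m); try lra.
        intros z Hz; apply (lower_bound_propagates_short D HD Hh y); try assumption; lra. }
  intros y m Hm p Hp.
  destruct (INR_unbounded ((y - p) / h)) as [n Hn].
  apply (K n y m Hm p); try lra.
  assert (y - p < INR n * h); [|lra].
  apply (Rmult_lt_compat_r h) in Hn; [|assumption].
  replace ((y - p) / h * h) with (y - p) in Hn by (field; lra).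
  assumption.
Qed.

(** The condition compares [D x] with a mean over a short interval only.
    Chaining it [n] times lets the mean over a fixed interval [z, z + h] bound
    [D - m] from below at all points within distance [(n + 1) h] behind [z]. *)
Lemma harnack_chain (D : R -> R) :
  (forall x, continuous D x) -> dominates_forward_mean D ->
  forall n, exists delta, 0 < delta /\ forall z m p,
    (forall t, x0 <= t <= z + S -> m <= D t) ->
    x0 <= p -> z - (INR n + 1) * h <= p <= z ->
    delta * RInt (fun t => D t - m) z (z + h) <= D p - m.
Proof.
  intros HD Hh.
  induction n as [|n [delta [Hd IH]]].
  - exists eps; split; [assumption|].
    intros z m p Hm Hp0 Hp; simpl in Hp.
    apply Rle_trans with (eps * RInt (fun t => D t - m) p (p + 2 * h)).
    + apply Rmult_le_compat_l; [lra|].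
      apply RInt_subinterval_le; try lra.
      * now apply continuous_sub_const.
      * intros x Hx; assert (m <= D x) by (apply Hm; lra); lra.
    + apply Hh; [assumption | intros; apply Hm; lra].
  - exists (delta * Rmin 1 (eps * h)).
    assert (Heh : 0 < eps * h) by (apply Rmult_lt_0_compat; lra).
    assert (Hmin : 0 < Rmin 1 (eps * h)) by (apply Rmin_glb_lt; lra).
    split; [apply Rmult_lt_0_compat; assumption|].
    intros z m p Hm Hp0 Hp; rewrite S_INR in Hp.
    set (J := RInt (fun t => D t - m) z (z + h)).
    assert (HJ : 0 <= J).
    { apply RInt_ge_0; [lra | apply ex_RInt_everywhere_continuous; now apply continuous_sub_const |].
      intros x Hx; assert (m <= D x) by (apply Hm; lra); lra. }
    assert (HdJ : 0 <= delta * J) by (apply Rmult_le_pos; lra).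
    assert (Hn := pos_INR n).
    assert (Hnh : 0 <= INR n * h) by (apply Rmult_le_pos; lra).
    replace (delta * Rmin 1 (eps * h) * J) with (Rmin 1 (eps * h) * (delta * J)) by ring.
    destruct (Rle_dec (z - (INR n + 1) * h) p) as [H1|H1].
    + apply Rle_trans with (1 * (delta * J)).
      * apply Rmult_le_compat_r; [assumption | apply Rmin_l].
      * rewrite Rmult_1_l; apply IH; try assumption; lra.
    + apply Rle_trans with (eps * h * (delta * J));
        [apply Rmult_le_compat_r; [assumption | apply Rmin_r]|].
      set (w := z - (INR n + 1) * h) in *.
      assert (Hw : w = z - INR n * h - h) by (unfold w; ring).
      apply Rle_trans with (eps * RInt (fun t => D t - m) p (p + 2 * h));
        [|apply Hh; [assumption | intros; apply Hm; lra]].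
      rewrite Rmult_assoc; apply Rmult_le_compat_l; [lra|].
      apply Rle_trans with (RInt (fun t => D t - m) w (w + h)).
      * replace h with (w + h - w) at 1 by ring.
        apply RInt_ge_const; [now apply continuous_sub_const | lra |].
        intros x Hx; apply IH; try assumption; try lra.
      * apply RInt_subinterval_le; try lra.
        -- now apply continuous_sub_const.
        -- intros x Hx; assert (m <= D x) by (apply Hm; lra); lra.
Qed.

(** Let [m] and [M] be the extrema of [D] on the later window.  The means of
    [D - m] and [M - D] over a common interval add up to [M - m], so one of
    them is at least half of it; by the Harnack chain all values on the earlier
    window then keep a definite distance from [m], or all from [M]. *)
Lemma oscillation_contracts (D : R -> R) :
  (forall x, continuous D x) ->
  dominates_forward_mean D -> dominates_forward_mean (fun x => - D x) ->
  exists theta, 0 <= theta < 1 /\ forall omega y, x0 <= y ->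
    (forall a b, y + 2 * S <= a <= y + 3 * S -> y + 2 * S <= b <= y + 3 * S ->
       D a - D b <= omega) ->
    forall a b, y <= a <= y + S -> y <= b <= y + S -> D a - D b <= theta * omega.
Proof.
  intros HD Hlo Hup.
  assert (HD' := continuous_opp_fun D HD).
  destruct (INR_unbounded (S / h)) as [n Hn].
  apply (Rmult_lt_compat_r h) in Hn; [|assumption].
  replace (S / h * h) with S in Hn by (field; lra).
  destruct (harnack_chain D HD Hlo n) as [d1 [Hd1 H1]].
  destruct (harnack_chain _ HD' Hup n) as [d2 [Hd2 H2]].
  set (d := Rmin 1 (Rmin d1 d2)).
  assert (Hd : 0 < d) by (unfold d; repeat apply Rmin_glb_lt; lra).
  assert (Hd1' : d <= d1)
    by (unfold d; eapply Rle_trans; [apply Rmin_r | apply Rmin_l]).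
  assert (Hd2' : d <= d2)
    by (unfold d; eapply Rle_trans; [apply Rmin_r | apply Rmin_r]).
  set (k := Rmin 1 (d * (h / 2))).
  assert (Hk : 0 < k) by (unfold k; apply Rmin_glb_lt; [lra | apply Rmult_lt_0_compat; lra]).
  assert (Hk1 : k <= 1) by apply Rmin_l.
  assert (Hk2 : k <= d * (h / 2)) by apply Rmin_r.
  exists (1 - k); split; [lra|].
  intros omega y Hy Hom.
  destruct (continuous_min D (y + 2 * S) (y + 3 * S) HD ltac:(lra)) as [q1 [Hq1 Hmin]].
  destruct (continuous_min _ (y + 2 * S) (y + 3 * S) HD' ltac:(lra)) as [q2 [Hq2 Hmax]].
  set (m := D q1) in *. set (M := D q2) in *.
  assert (HMm : M - m <= omega) by (apply Hom; assumption).
  assert (HmM : m <= M) by (assert (m <= D q2) by (apply Hmin; lra); assumption).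
  assert (Hm : forall t, x0 <= t <= y + 3 * S -> m <= D t).
  { intros t Ht; apply (lower_bound_propagates D HD Hlo (y + 2 * S)); [|lra].
    intros z Hz; apply Hmin; lra. }
  assert (HM : forall t, x0 <= t <= y + 3 * S -> - M <= - D t).
  { intros t Ht; apply (lower_bound_propagates _ HD' Hup (y + 2 * S)); [|lra].
    intros z Hz; apply Hmax; lra. }
  set (z := y + S).
  assert (Hz : z = y + S) by reflexivity.
  assert (Hsum : RInt (fun t => D t - m) z (z + h) + RInt (fun t => - D t - - M) z (z + h)
                 = h * (M - m)).
  { assert (E : forall g : R -> R, (forall x, continuous g x) -> forall u v, ex_RInt g u v)
      by (intros; now apply ex_RInt_everywhere_continuous).
    rewrite <- (RInt_plus (V := R_CompleteNormedModule));
      try (apply E; now apply continuous_sub_const).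
    rewrite (RInt_ext _ (fun _ => M - m)).
    - rewrite RInt_const; unfold scal; simpl; unfold mult; simpl; ring.
    - intros; unfold plus; simpl; ring. }
  assert (Hnn : forall p, y <= p <= y + S -> z - (INR n + 1) * h <= p <= z)
    by (intros p Hp; lra).
  assert (Hkw : k * (M - m) <= d * (h / 2 * (M - m))).
  { rewrite <- Rmult_assoc; apply Rmult_le_compat_r; lra. }
  assert (Hpos : 0 <= h / 2 * (M - m)) by (apply Rmult_le_pos; lra).
  assert (Hfin : (1 - k) * (M - m) <= (1 - k) * omega) by (apply Rmult_le_compat_l; lra).
  intros a b Ha Hb; fold z in Ha, Hb.
  apply Rle_trans with ((1 - k) * (M - m)); [|assumption].
  assert (HaM := HM a ltac:(lra)). assert (Hbm := Hm b ltac:(lra)).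
  destruct (Rle_dec (h / 2 * (M - m)) (RInt (fun t => D t - m) z (z + h))) as [Hc|Hc].
  - assert (Hb1 := H1 z m b ltac:(intros; apply Hm; lra) ltac:(lra) (Hnn b Hb)).
    assert (d * (h / 2 * (M - m)) <= d1 * RInt (fun t => D t - m) z (z + h))
      by (apply Rmult_le_compat; lra).
    lra.
  - assert (Ha1 := H2 z (- M) a ltac:(intros; apply HM; lra) ltac:(lra) (Hnn a Ha)).
    assert (d * (h / 2 * (M - m)) <= d2 * RInt (fun t => - D t - - M) z (z + h))
      by (apply Rmult_le_compat; lra).
    lra.
Qed.

(** After [n] contractions the oscillation at [y] is compared with that of a
    window far ahead, so a bound on the oscillation that is uniform in the
    window takes the place of a bound on [D]. *)
Theorem forward_mean_liouville (D : R -> R) (B : R) :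
  (forall x, continuous D x) ->
  dominates_forward_mean D -> dominates_forward_mean (fun x => - D x) ->
  (forall x z, x0 <= x -> x <= z <= x + S -> Rabs (D z - D x) <= B) ->
  forall x y, x0 <= x -> x0 <= y -> D x = D y.
Proof.
  intros HD Hlo Hup HB.
  destruct (oscillation_contracts D HD Hlo Hup) as [theta [Hth Hc]].
  assert (Hpow : forall n y a b, x0 <= y -> y <= a <= y + S -> y <= b <= y + S ->
            D a - D b <= theta ^ n * (2 * B)).
  { induction n as [|n IH]; intros y a b Hy Ha Hb.
    - simpl.
      assert (H1 := HB y a Hy Ha). assert (H2 := HB y b Hy Hb).
      apply Rabs_le_between in H1; apply Rabs_le_between in H2; lra.
    - simpl; rewrite Rmult_assoc; apply (Hc _ y); try assumption.
      intros a' b' Ha' Hb'; apply (IH (y + 2 * S)); lra. }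
  assert (Hloc : forall y a b, x0 <= y -> y <= a <= y + S -> y <= b <= y + S -> D a <= D b).
  { intros y a b Hy Ha Hb.
    assert (HBn : 0 <= B)
      by (eapply Rle_trans; [apply Rabs_pos | apply (HB y y); lra]).
    assert (Hlim : is_lim_seq (fun n => theta ^ n * (2 * B)) (0 * (2 * B))).
    { apply (is_lim_seq_scal_r _ (2 * B) 0), is_lim_seq_geom.
      rewrite Rabs_pos_eq; lra. }
    assert (Hle := is_lim_seq_le _ _ (Finite (D a - D b)) (Finite (0 * (2 * B)))
      (fun n => Hpow n y a b Hy Ha Hb) (is_lim_seq_const _) Hlim).
    simpl in Hle; lra. }
  assert (Hup' : forall n x y, x0 <= x -> x <= y <= x + INR n * S -> D x = D y).
  { induction n as [|n IH]; intros x y Hx Hy.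
    - simpl in Hy; f_equal; lra.
    - rewrite S_INR in Hy.
      destruct (Rle_dec y (x + S)) as [H|H].
      + apply Rle_antisym; apply (Hloc x); lra.
      + rewrite <- (IH (x + S) y); try lra.
        apply Rle_antisym; apply (Hloc x); lra. }
  assert (Hfwd : forall x y, x0 <= x -> x <= y -> D x = D y).
  { intros x y Hx Hy.
    destruct (INR_unbounded ((y - x) / S)) as [n Hn].
    apply (Rmult_lt_compat_r S) in Hn; [|lra].
    replace ((y - x) / S * S) with (y - x) in Hn by (field; lra).
    apply (Hup' n); lra. }
  intros x y Hx Hy.
  destruct (Rle_dec x y); [|symmetry]; apply Hfwd; lra.
Qed.

End ForwardMean.

(** [F] stands for [k * (E - E x)] with a kernel [k] between [alpha] and
    [beta].  The pointwise inequality
    [F z >= alpha * (E z - m) - beta * (E x - m)] holds for either sign of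
    [E z - E x], and integrating it gives the forward mean condition. *)
Lemma forward_mean_of_balance (E F : R -> R) (x L S h alpha beta m : R) :
  (forall z, continuous E z) -> (forall z, continuous F z) ->
  0 < h -> 2 * h <= L -> L <= S -> 0 < alpha -> alpha <= beta ->
  RInt F x (x + L) = 0 ->
  (forall z, x <= z <= x + L ->
     (E x <= E z -> alpha * (E z - E x) <= F z) /\
     (E z <= E x -> - F z <= beta * (E x - E z))) ->
  (forall z, x <= z <= x + S -> m <= E z) ->
  alpha / (beta * S) * RInt (fun z => E z - m) x (x + 2 * h) <= E x - m.
Proof.
  intros HE HF Hh HhL HLS Ha Hab H0 Hk Hm.
  assert (Hmx : m <= E x) by (apply Hm; lra).
  set (I := RInt (fun z => E z - m) x (x + L)).
  assert (HIle : RInt (fun z => E z - m) x (x + 2 * h) <= I).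
  { apply RInt_subinterval_le; try lra.
    - now apply continuous_sub_const.
    - intros z Hz; assert (m <= E z) by (apply Hm; lra); lra. }
  assert (HI : alpha * I <= beta * L * (E x - m)).
  { assert (Hle : RInt (fun z => alpha * (E z - m) - beta * (E x - m)) x (x + L)
                  <= RInt F x (x + L)).
    { apply RInt_le; try (apply ex_RInt_everywhere_continuous); try lra; try assumption.
      - apply continuous_sub_const.
        intros z; apply (continuous_scal_r (K := R_AbsRing) (V := R_NormedModule) alpha
                           (fun z => E z - m)).
        now apply continuous_sub_const.
      - intros z Hz; destruct (Hk z ltac:(lra)) as [H1 H2].
        assert (Hmz : m <= E z) by (apply Hm; lra).
        destruct (Rle_dec (E x) (E z)) as [Hc|Hc].
        + specialize (H1 Hc).
          assert (alpha * (E x - m) <= beta * (E x - m))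
            by (apply Rmult_le_compat_r; lra); lra.
        + specialize (H2 ltac:(lra)).
          assert (alpha * (E z - m) <= beta * (E z - m))
            by (apply Rmult_le_compat_r; lra); lra. }
    rewrite H0 in Hle.
    assert (Eq : RInt (fun z => alpha * (E z - m) - beta * (E x - m)) x (x + L)
                 = alpha * I - L * (beta * (E x - m))).
    { assert (Hc : forall z, continuous (fun z => E z - m) z)
        by now apply continuous_sub_const.
      assert (Hc' : forall z, continuous (fun z => alpha * (E z - m)) z).
      { intros z; apply (continuous_scal_r (K := R_AbsRing) (V := R_NormedModule) alpha
                           (fun z => E z - m)); apply Hc. }
      assert (E1 := RInt_minus (V := R_CompleteNormedModule) _ _ x (x + L)
        (ex_RInt_everywhere_continuous _ x (x + L) Hc')
        (ex_RInt_const x (x + L) (beta * (E x - m)))).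
      assert (E2 := RInt_scal (V := R_CompleteNormedModule) _ x (x + L) alpha
        (ex_RInt_everywhere_continuous _ x (x + L) Hc)).
      assert (E3 : RInt (fun _ => beta * (E x - m)) x (x + L) = (x + L - x) * (beta * (E x - m)))
        by exact (RInt_const x (x + L) (beta * (E x - m))).
      assert (E2' : RInt (fun z => alpha * (E z - m)) x (x + L) = alpha * I) by exact E2.
      assert (E1' : RInt (fun z => alpha * (E z - m) - beta * (E x - m)) x (x + L)
        = RInt (fun z => alpha * (E z - m)) x (x + L)
          - RInt (fun _ => beta * (E x - m)) x (x + L)) by exact E1.
      lra. }
    lra. }
  assert (HbS : 0 < beta * S) by (apply Rmult_lt_0_compat; lra).
  apply Rmult_le_reg_l with (beta * S); [assumption|].
  replace (beta * S * (alpha / (beta * S) * RInt (fun z => E z - m) x (x + 2 * h)))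
    with (alpha * RInt (fun z => E z - m) x (x + 2 * h)) by (field; split; apply Rgt_not_eq; lra).
  apply Rle_trans with (alpha * I); [apply Rmult_le_compat_l; lra|].
  eapply Rle_trans; [apply HI|].
  apply Rmult_le_compat_r; [lra | apply Rmult_le_compat_l; lra].
Qed.

(** * Fronts between two density levels *)

(** The flux divided by the speed limit. *)
Definition flow (phi : R -> R) (w : R) : R := w * phi w.

Section Fronts.

Variables (l a b K c : R) (phi : R -> R).
Hypotheses (l_pos : 0 < l) (a_pos : 0 < a) (a_b : a < b) (b_lt_1 : b < 1).
Hypothesis phi_b_pos : 0 < phi b.
Hypothesis phi_le_1 : forall w, a <= w <= b -> phi w <= 1.
Hypothesis c_pos : 0 < c.
Hypothesis phi_slope : forall v w, a <= v -> v <= w -> w <= b ->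
  c * (w - v) <= phi v - phi w <= K * (w - v).

Local Notation g := (flow phi).

Hypothesis flow_ends : g a = g b.
Hypothesis flow_concave : forall v w, a <= v -> v < w -> w < b ->
  (g v - g b) * (b - w) < (g w - g b) * (b - v).

Definition front_slope (W : R -> R) (x : R) : R :=
  W x ^ 2 / (l * phi (W x)) * (phi (W x) - phi (W (x + l / W x))).

(** The profiles of the nondegenerate case.  Densities are at least
    [a > 0], so the delayed argument is always finite. *)
Record front (W : R -> R) : Prop := {
  front_range : forall x, a <= W x <= b;
  front_mono : forall x y, x <= y -> W x <= W y;
  front_derive : forall x, is_derive W x (front_slope W x);
  front_near_a : forall eps, 0 < eps -> exists x, W x < a + eps;
  front_near_b : forall eps, 0 < eps -> exists x, b - eps < W x
}.

Lemma phi_ge_phi_b (w : R) : a <= w <= b -> phi b <= phi w.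
Proof.
  intros Hw; destruct (phi_slope w b) as [H _]; try lra.
  assert (0 <= c * (b - w)) by (apply Rmult_le_pos; lra); lra.
Qed.

Lemma K_pos : 0 < K.
Proof.
  destruct (phi_slope a b) as [H1 H2]; try lra.
  assert (0 < c * (b - a)) by (apply Rmult_lt_0_compat; lra).
  apply Rmult_lt_reg_r with (b - a); lra.
Qed.

Definition decay_rate : R := K / (l * phi b).

Local Notation C := decay_rate.

Lemma decay_rate_pos : 0 < C.
Proof.
  apply Rdiv_lt_0_compat; [apply K_pos | now apply Rmult_lt_0_compat].
Qed.

Lemma flow_gt_at_ends (w : R) : a < w < b -> g b < g w.
Proof.
  intros Hw.
  assert (H := flow_concave a w ltac:(lra) ltac:(lra) ltac:(lra)).
  rewrite flow_ends in H.
  apply Rmult_lt_reg_r with (b - a); lra.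
Qed.

Section OneFront.

Variable W : R -> R.
Hypothesis HW : front W.

Local Notation W_range := (front_range W HW).
Local Notation W_mono := (front_mono W HW).
Local Notation W_derive := (front_derive W HW).

Lemma front_pos (x : R) : 0 < W x.
Proof. assert (H := W_range x); lra. Qed.

Lemma headway_bounds (x : R) : l / b <= l / W x <= l / a.
Proof.
  assert (H := W_range x).
  split; apply Rmult_le_compat_l; try lra; apply Rinv_le_contravar; lra.
Qed.

Lemma headway_pos (x : R) : 0 < l / W x.
Proof. apply Rdiv_lt_0_compat; [assumption | apply front_pos]. Qed.

Lemma front_ahead_ge (x : R) : W x <= W (x + l / W x).
Proof. apply W_mono; assert (H := headway_pos x); lra. Qed.

Lemma front_phi_pos (x : R) : 0 < phi (W x).
Proof. assert (H := phi_ge_phi_b (W x) (W_range x)); lra. Qed.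

Lemma front_continuous (x : R) : continuous W x.
Proof. apply (ex_derive_continuous W); eexists; apply W_derive. Qed.

Lemma front_slope_upper (x : R) : front_slope W x <= C * (b - W x).
Proof.
  unfold front_slope, decay_rate.
  assert (Hx := W_range x). assert (Hy := W_range (x + l / W x)).
  assert (Hm := front_ahead_ge x).
  assert (Hphi := phi_ge_phi_b _ Hx). assert (HK := K_pos).
  destruct (phi_slope (W x) (W (x + l / W x))) as [H1 H2]; try lra.
  assert (0 <= c * (W (x + l / W x) - W x)) by (apply Rmult_le_pos; lra).
  assert (Hd : phi (W x) - phi (W (x + l / W x)) <= K * (b - W x)).
  { eapply Rle_trans; [apply H2|]; apply Rmult_le_compat_l; lra. }
  apply Rle_trans with (1 / (l * phi b) * (K * (b - W x))).
  - apply Rmult_le_compat; try lra.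
    + apply Rdiv_le_0_compat; [apply pow_le; lra|].
      apply Rmult_lt_0_compat; lra.
    + apply Rmult_le_compat.
      * apply pow_le; lra.
      * left; apply Rinv_0_lt_compat, Rmult_lt_0_compat; lra.
      * rewrite <- (pow1 2); apply pow_incr; lra.
      * apply Rinv_le_contravar; [apply Rmult_lt_0_compat; lra|].
        apply Rmult_le_compat_l; lra.
  - right; field; lra.
Qed.

(** Gronwall: [(b - W) * exp (C x)] is nondecreasing.  Hence the gap [b - W]
    never closes, and on a headway interval it shrinks by a bounded factor at
    most. *)
Lemma front_gap_decay (x y : R) :
  x <= y -> (b - W x) * exp (- C * (y - x)) <= b - W y.
Proof.
  intros Hxy.
  destruct (mean_value (fun t => (b - W t) * exp (C * t))
    (fun t => (C * (b - W t) - front_slope W t) * exp (C * t)) x y) as [xi [_ E]].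
  - intros t.
    assert (Ht := W_derive t).
    auto_derive; [eexists; apply Ht|].
    rewrite (is_derive_unique (fun x : R => W x) t _ Ht); ring.
  - assumption.
  - assert (0 <= (C * (b - W xi) - front_slope W xi) * exp (C * xi) * (y - x)).
    { repeat apply Rmult_le_pos; try lra.
      - assert (H := front_slope_upper xi); lra.
      - left; apply exp_pos. }
    apply Rmult_le_reg_r with (exp (C * y)); [apply exp_pos|].
    rewrite Rmult_assoc, <- exp_plus.
    replace (- C * (y - x) + C * y) with (C * x) by ring.
    simpl in E; lra.
Qed.

Lemma front_lt_b (x : R) : W x < b.
Proof.
  destruct (front_near_a W HW (b - a)) as [x1 Hx1]; [lra|].
  destruct (Rle_dec x1 x) as [H|H].
  - assert (Hd := front_gap_decay x1 x H).
    assert (0 < (b - W x1) * exp (- C * (x - x1)))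
      by (apply Rmult_lt_0_compat; [lra | apply exp_pos]).
    lra.
  - assert (W x <= W x1) by (apply W_mono; lra); lra.
Qed.

Lemma front_slope_zero (x : R) : front_slope W x = 0 -> W (x + l / W x) = W x.
Proof.
  unfold front_slope; intros H.
  assert (Hx := W_range x). assert (Hy := W_range (x + l / W x)).
  assert (Hm := front_ahead_ge x). assert (Hphi := front_phi_pos x).
  apply Rmult_integral in H; destruct H as [H|H].
  - exfalso; revert H; apply Rgt_not_eq, Rdiv_lt_0_compat.
    + apply pow_lt; lra.
    + now apply Rmult_lt_0_compat.
  - destruct (phi_slope (W x) (W (x + l / W x))) as [H1 _]; try lra.
    destruct Hm as [Hm|Hm]; [|now symmetry].
    assert (0 < c * (W (x + l / W x) - W x)) by (apply Rmult_lt_0_compat; lra); lra.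
Qed.

Lemma front_slope_zero_inside_plateau (s t y : R) :
  s < y < t -> W t = W s -> front_slope W y = 0.
Proof.
  intros Hy Hst.
  assert (Hd : is_derive W y 0).
  { apply is_derive_ext_loc with (fun _ => W s).
    - assert (Hr : 0 < Rmin (y - s) (t - y)) by (apply Rmin_glb_lt; lra).
      exists (mkposreal _ Hr); intros z Hz.
      assert (Hz' : Rabs (z - y) < Rmin (y - s) (t - y)) by exact Hz.
      apply Rabs_lt_between in Hz'.
      assert (H1 := Rmin_l (y - s) (t - y)). assert (H2 := Rmin_r (y - s) (t - y)).
      assert (W s <= W z) by (apply W_mono; lra).
      assert (W z <= W t) by (apply W_mono; lra); lra.
    - apply (is_derive_const (K := R_AbsRing) (V := R_NormedModule)). }
  rewrite <- (is_derive_unique W y _ (W_derive y)).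
  now apply is_derive_unique.
Qed.

(** If [W] takes the same value at [x] and one headway ahead, it is constant in
    between; the slope vanishes inside this plateau, so the points inside also
    have equal density one headway ahead and the plateau extends.  It would
    reach +infinity, at a level below [b]. *)
Lemma front_ahead_gt (x : R) : W x < W (x + l / W x).
Proof.
  destruct (front_ahead_ge x) as [H|H]; [assumption|exfalso].
  set (L := l / W x) in *.
  assert (HL : 0 < L) by apply headway_pos.
  assert (Hn : forall n, W (x + L + INR n * (L / 2)) = W x).
  { induction n as [|n IH].
    - simpl; rewrite Rmult_0_l, Rplus_0_r; now symmetry.
    (* Strides of half a headway keep the next base point inside the plateau,
       where the two-sided derivative is known to vanish. *)
    - set (y := x + INR (S n) * (L / 2)).
      assert (Hy : x < y < x + L + INR n * (L / 2)).
      { assert (Hn := pos_INR n); unfold y; rewrite S_INR.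
        assert (0 <= INR n * (L / 2)) by (apply Rmult_le_pos; lra); lra. }
      assert (E := front_slope_zero y (front_slope_zero_inside_plateau x _ y Hy IH)).
      assert (Ey : W y = W x).
      { assert (W x <= W y) by (apply W_mono; lra).
        assert (W y <= W (x + L + INR n * (L / 2))) by (apply W_mono; lra); lra. }
      rewrite Ey in E; fold L in E; rewrite <- E; f_equal; unfold y; ring. }
  assert (Hb := front_lt_b x).
  destruct (front_near_b W HW (b - W x)) as [z Hz]; [lra|].
  destruct (INR_unbounded ((z - x) / (L / 2))) as [n Hnz].
  apply (Rmult_lt_compat_r (L / 2)) in Hnz; [|lra].
  replace ((z - x) / (L / 2) * (L / 2)) with (z - x) in Hnz by (field; lra).
  assert (W z <= W (x + L + INR n * (L / 2))) by (apply W_mono; lra).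
  rewrite Hn in *; lra.
Qed.

Lemma front_increasing (x y : R) : x < y -> W x < W y.
Proof.
  intros Hxy.
  destruct (W_mono x y ltac:(lra)) as [H|H]; [assumption|exfalso].
  assert (Hz : x < (x + y) / 2 < y) by lra.
  assert (E := front_slope_zero _ (front_slope_zero_inside_plateau x y _ Hz (eq_sym H))).
  assert (Hgt := front_ahead_gt ((x + y) / 2)); lra.
Qed.

Lemma front_gt_a (x : R) : a < W x.
Proof.
  assert (H := W_range (x - 1)).
  assert (W (x - 1) < W x) by (apply front_increasing; lra); lra.
Qed.

Lemma inv_phi_front_continuous (x : R) : continuous (fun z => / phi (W z)) x.
Proof.
  apply (continuous_Rinv_comp (fun z => phi (W z))).
  - apply continuous_eps_delta; intros eps Heps.
    assert (HK := K_pos).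
    destruct (eps_delta_continuous W x (eps / K)) as [d [Hd Hy]];
      [apply front_continuous | now apply Rdiv_lt_0_compat |].
    exists d; split; [assumption|]; intros y Hyx.
    apply Rle_lt_trans with (K * Rabs (W y - W x)).
    + assert (Hyr := W_range y). assert (Hxr := W_range x).
      destruct (Rle_dec (W x) (W y)) as [Hle|Hle].
      * destruct (phi_slope (W x) (W y)) as [H1 H2]; try lra.
        assert (0 <= c * (W y - W x)) by (apply Rmult_le_pos; lra).
        rewrite (Rabs_pos_eq (W y - W x)), Rabs_minus_sym, Rabs_pos_eq; lra.
      * destruct (phi_slope (W y) (W x)) as [H1 H2]; try lra.
        assert (0 <= c * (W x - W y)) by (apply Rmult_le_pos; lra).
        rewrite (Rabs_minus_sym (W y)), (Rabs_pos_eq (W x - W y)), Rabs_pos_eq; lra.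
    + specialize (Hy y Hyx); apply (Rmult_lt_compat_l K) in Hy; [|assumption].
      replace (K * (eps / K)) with eps in Hy by (field; lra); assumption.
  - apply Rgt_not_eq, front_phi_pos.
Qed.

(** Up to the factor given by the speed limit, the time that the car at [x]
    needs to reach the position of its leader. *)
Definition travel (x : R) : R := RInt (fun z => / phi (W z)) x (x + l / W x).

(** The derivative of the travel time is
    [(1 - l W' / W ^ 2) / phi (W (x + l / W x)) - 1 / phi (W x)], and the
    delay equation says exactly that this is zero. *)
Lemma travel_constant (x y : R) : travel x = travel y.
Proof.
  set (P := fun z => / phi (W z)).
  assert (HP : forall z, continuous P z) by exact inv_phi_front_continuous.
  assert (HE : forall z, is_derive (fun t => RInt P 0 t) z (P z)).
  { intros z; apply (is_derive_RInt P _ 0); [|apply HP].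
    exists (mkposreal 1 Rlt_0_1); intros t _.
    apply (RInt_correct P), ex_RInt_everywhere_continuous, HP. }
  assert (HT : forall z, travel z = RInt P 0 (z + l / W z) - RInt P 0 z).
  { intros z; unfold travel; fold P.
    rewrite <- (RInt_Chasles P 0 z (z + l / W z))
      by now apply ex_RInt_everywhere_continuous.
    unfold plus; simpl; lra. }
  assert (HD : forall z, is_derive travel z 0).
  { intros z.
    apply is_derive_ext with (fun z => RInt P 0 (z + l / W z) - RInt P 0 z);
      [intros; symmetry; apply HT|].
    assert (Hh : is_derive (fun z => z + l / W z) z (1 - l * front_slope W z / (W z) ^ 2)).
    { assert (Hz := W_derive z).
      assert (HWz := front_pos z).
      auto_derive; [split; [eexists; apply Hz | split; [lra | exact I]]|].
      rewrite (is_derive_unique (fun x : R => W x) z _ Hz); field; lra. }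
    assert (Hc := is_derive_comp (fun t => RInt P 0 t) (fun z => z + l / W z) z _ _ (HE _) Hh).
    assert (Hm : is_derive (fun z => RInt P 0 (z + l / W z) - RInt P 0 z) z
              ((1 - l * front_slope W z / (W z) ^ 2) * P (z + l / W z) - P z))
      by exact (is_derive_minus _ _ z _ _ Hc (HE z)).
    assert (E : (1 - l * front_slope W z / (W z) ^ 2) * P (z + l / W z) - P z = 0).
    { unfold P, front_slope.
      assert (HWz := front_pos z). assert (H1 := front_phi_pos z).
      assert (H2 := front_phi_pos (z + l / W z)).
      field; lra. }
    rewrite E in Hm; exact Hm. }
  assert (Hxy : forall x y, x <= y -> travel x = travel y).
  { intros s t Hst.
    destruct (mean_value travel (fun _ => 0) s t HD Hst) as [xi [_ E]]; lra. }
  destruct (Rle_dec x y); [|symmetry]; apply Hxy; lra.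
Qed.

Lemma travel_bounds (x : R) :
  l / W x * / phi (W x) <= travel x <= l / W x * / phi (W (x + l / W x)).
Proof.
  assert (HL := headway_pos x).
  assert (Hmono : forall s t, s <= t -> / phi (W s) <= / phi (W t)).
  { intros s t Hst; apply Rinv_le_contravar; [apply front_phi_pos|].
    assert (Hs := W_range s). assert (Ht := W_range t). assert (Hm := W_mono s t Hst).
    destruct (phi_slope (W s) (W t)) as [H _]; try lra.
    assert (0 <= c * (W t - W s)) by (apply Rmult_le_pos; lra); lra. }
  assert (Hex : forall s t, ex_RInt (fun z => / phi (W z)) s t)
    by (intros; apply ex_RInt_everywhere_continuous, inv_phi_front_continuous).
  unfold travel; split.
  - replace (l / W x) with (x + l / W x - x) at 1 by ring.
    apply RInt_ge_const; [apply inv_phi_front_continuous | lra |].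
    intros z Hz; apply Hmono; lra.
  - replace (l / W x * / phi (W (x + l / W x)))
      with (RInt (fun _ => / phi (W (x + l / W x))) x (x + l / W x)).
    + apply RInt_le; [lra | apply Hex | apply ex_RInt_const |].
      intros z Hz; apply Hmono; lra.
    + rewrite RInt_const; unfold scal; simpl; unfold mult; simpl; ring.
Qed.

Lemma front_close_to_b (M eps : R) :
  0 <= M -> 0 < eps -> exists y, M * (b - W y) <= eps.
Proof.
  intros HM Heps.
  destruct (front_near_b W HW (eps / (M + 1))) as [y Hy].
  - apply Rdiv_lt_0_compat; lra.
  - exists y.
    assert (Hb := W_range y).
    apply Rle_trans with ((M + 1) * (b - W y)).
    + apply Rmult_le_compat_r; lra.
    + apply Rle_trans with ((M + 1) * (eps / (M + 1))).
      * apply Rmult_le_compat_l; lra.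
      * right; field; lra.
Qed.

(** The travel time at [y] lies between [l / (W y * phi (W y))] and
    [l / (W y * phi b)], and both tend to the same limit as [W y] tends to
    [b]. *)
Lemma travel_value (x : R) : travel x = l / g b.
Proof.
  unfold flow.
  assert (HK := K_pos).
  assert (HT : 0 < travel x).
  { destruct (travel_bounds x) as [H _]; eapply Rlt_le_trans; [|apply H].
    apply Rmult_lt_0_compat; [apply headway_pos | apply Rinv_0_lt_compat, front_phi_pos]. }
  assert (Hy : forall y, W y * phi b * travel x <= l <= W y * phi (W y) * travel x).
  { intros y; rewrite (travel_constant x y).
    destruct (travel_bounds y) as [H1 H2].
    assert (HWy := front_pos y). assert (Hphi := front_phi_pos y).
    split.
    - apply Rle_trans with (W y * phi b * (l / W y * / phi b)).
      + apply Rmult_le_compat_l; [apply Rmult_le_pos; lra|].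
        eapply Rle_trans; [apply H2|].
        apply Rmult_le_compat_l; [left; apply headway_pos|].
        apply Rinv_le_contravar; [assumption|].
        apply phi_ge_phi_b, W_range.
      + right; field; lra.
    - apply Rle_trans with (W y * phi (W y) * (l / W y * / phi (W y))).
      + right; field; lra.
      + apply Rmult_le_compat_l; [apply Rmult_le_pos; lra | assumption]. }
  assert (Hb : b * phi b * travel x = l).
  { apply Rle_antisym; apply le_epsilon; intros eps Heps.
    - destruct (front_close_to_b (phi b * travel x) eps) as [y Hye];
        [apply Rmult_le_pos; lra | assumption |].
      destruct (Hy y) as [H _]; lra.
    - destruct (front_close_to_b (b * K * travel x) eps) as [y Hye];
        [repeat apply Rmult_le_pos; lra | assumption |].
      destruct (Hy y) as [_ H].
      assert (Hr := W_range y). assert (HWy := front_pos y).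
      destruct (phi_slope (W y) b) as [_ Hs]; try lra.
      apply Rle_trans with (b * (phi b + K * (b - W y)) * travel x); [|lra].
      eapply Rle_trans; [apply H|].
      apply Rmult_le_compat_r; [lra|].
      apply Rmult_le_compat; try lra.
      left; apply front_phi_pos. }
  apply (Rmult_eq_reg_l (b * phi b)).
  - rewrite Hb; field; lra.
  - apply Rgt_not_eq, Rmult_lt_0_compat; lra.
Qed.

(** The travel time is at most [l / (W x * phi (W (x + l / W x)))], so
    [W x * phi] one headway ahead is at most [g b].  Hence the drop of [phi]
    over a headway is at least [(g (W x) - g b) / W x], which concavity of the
    flow bounds below by a multiple of [b - W x]. *)
Lemma front_slope_lower (w1 x : R) :
  a < w1 < b -> w1 <= W x ->
  a ^ 2 / l * (g w1 - g b) * (b - W x) <= front_slope W x.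
Proof.
  intros Hw1 Hx.
  assert (Hb := front_lt_b x). assert (Hpos := front_pos x). assert (Hgt := front_gt_a x).
  assert (Hphi := front_phi_pos x).
  assert (Hpp := front_phi_pos (x + l / W x)).
  assert (Hg1 := flow_gt_at_ends w1 Hw1).
  assert (Hgx := flow_gt_at_ends (W x) ltac:(lra)).
  assert (Hchord : (g w1 - g b) * (b - W x) <= g (W x) - g b).
  { apply Rle_trans with ((g (W x) - g b) * (b - w1)).
    - destruct Hx as [Hx|Hx]; [left; now apply flow_concave; try lra | rewrite <- Hx; lra].
    - rewrite <- (Rmult_1_r (g (W x) - g b)) at 2; apply Rmult_le_compat_l; lra. }
  assert (Hahead : W x * phi (W (x + l / W x)) <= g b).
  { destruct (travel_bounds x) as [_ H]; rewrite travel_value in H.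
    assert (Hgb : 0 < g b) by (unfold flow; apply Rmult_lt_0_compat; lra).
    apply Rmult_le_reg_l with (l / g b * / W x * / phi (W (x + l / W x))).
    - repeat apply Rmult_lt_0_compat; try assumption;
        apply Rinv_0_lt_compat; assumption.
    - apply Rle_trans with (l / g b); [right; field; lra|].
      eapply Rle_trans; [apply H|]; right; field; lra. }
  set (dphi := phi (W x) - phi (W (x + l / W x))).
  assert (Hdphi : (g w1 - g b) * (b - W x) <= dphi).
  { assert (Hd : (g w1 - g b) * (b - W x) <= W x * dphi)
      by (unfold dphi; unfold flow at 3 in Hchord; lra).
    assert (0 <= (g w1 - g b) * (b - W x)) by (apply Rmult_le_pos; lra).
    assert (0 <= dphi).
    { apply Rmult_le_reg_l with (W x); lra. }
    assert (W x * dphi <= 1 * dphi) by (apply Rmult_le_compat_r; lra).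
    lra. }
  unfold front_slope; fold dphi; rewrite Rmult_assoc.
  assert (Hr := W_range x).
  apply Rmult_le_compat; try assumption.
  - apply Rdiv_le_0_compat; [apply pow_le; lra | lra].
  - apply Rmult_le_pos; lra.
  - apply Rmult_le_compat.
    + apply pow_le; lra.
    + left; now apply Rinv_0_lt_compat.
    + apply pow_incr; lra.
    + assert (Hle := phi_le_1 (W x) Hr).
      apply Rinv_le_contravar; [now apply Rmult_lt_0_compat|].
      rewrite <- (Rmult_1_r l) at 2; apply Rmult_le_compat_l; lra.
Qed.

Lemma front_increment_bounds (w1 w r s t : R) :
  a < w1 < b -> w1 <= w -> s <= t -> w <= W s -> r * (b - w) <= b - W t -> 
  a ^ 2 / l * (g w1 - g b) * (r * (b - w)) * (t - s) <= W t - W s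
  /\ W t - W s <= C * (b - w) * (t - s).
Proof.
  intros Hw1 Hw Hst Hs Ht.
  destruct (mean_value W (front_slope W) s t W_derive Hst) as [xi [Hxi E]].
  assert (H1 : W s <= W xi) by (apply W_mono; lra).
  assert (H2 : W xi <= W t) by (apply W_mono; lra).
  rewrite E; split; (apply Rmult_le_compat_r; [lra|]).
  - eapply Rle_trans; [|apply (front_slope_lower w1); lra].
    apply Rmult_le_compat_l; [|lra].
    apply Rmult_le_pos.
    + apply Rdiv_le_0_compat; [apply pow_le; lra | lra].
    + assert (H := flow_gt_at_ends w1 Hw1); lra.
  - eapply Rle_trans; [apply front_slope_upper|].
    assert (HC := decay_rate_pos); apply Rmult_le_compat_l; lra.
Qed.

Lemma inv_phi_increment_bounds (w1 w r s t : R) :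
  a < w1 < b -> w1 <= w -> s <= t -> w <= W s -> r * (b - w) <= b - W t -> 
  c * (a ^ 2 / l * (g w1 - g b)) * r * (b - w) * (t - s)
    <= / phi (W t) - / phi (W s)
    <= K / (phi b) ^ 2 * C * (b - w) * (t - s).
Proof.
  intros Hw1 Hw Hst Hs Ht.
  destruct (front_increment_bounds w1 w r s t) as [H1 H2]; try assumption.
  assert (Hm := W_mono s t Hst).
  assert (Hrs := W_range s). assert (Hrt := W_range t).
  destruct (phi_slope (W s) (W t)) as [H3 H4]; try lra.
  assert (Hps := front_phi_pos s). assert (Hpt := front_phi_pos t).
  assert (Hbs := phi_ge_phi_b _ Hrs). assert (Hbt := phi_ge_phi_b _ Hrt).
  assert (H1s := phi_le_1 _ Hrs). assert (H1t := phi_le_1 _ Hrt).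
  assert (HK := K_pos).
  replace (/ phi (W t) - / phi (W s))
    with ((phi (W s) - phi (W t)) * / (phi (W s) * phi (W t))) by (field; lra).
  assert (Hpos : 0 <= c * (W t - W s)) by (apply Rmult_le_pos; lra).
  split.
  - apply Rle_trans with (c * (W t - W s)).
    + apply (Rmult_le_compat_l c) in H1; lra.
    + rewrite <- (Rmult_1_r (c * (W t - W s))).
      apply Rmult_le_compat; try lra.
      rewrite <- Rinv_1; apply Rinv_le_contravar; [now apply Rmult_lt_0_compat|].
      rewrite <- (Rmult_1_r 1); apply Rmult_le_compat; lra.
  - apply Rle_trans with (K * (W t - W s) * / (phi b) ^ 2).
    + apply Rmult_le_compat; try lra.
      * left; apply Rinv_0_lt_compat; now apply Rmult_lt_0_compat.
      * apply Rinv_le_contravar; [apply pow_lt; lra|].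
        simpl; rewrite Rmult_1_r; apply Rmult_le_compat; lra.
    + assert (Hk : 0 < K * / (phi b) ^ 2)
        by (apply Rmult_lt_0_compat; [lra | apply Rinv_0_lt_compat, pow_lt; lra]).
      apply (Rmult_le_compat_l (K * / (phi b) ^ 2)) in H2; [|lra].
      unfold Rdiv; lra.
Qed.

End OneFront.

(** * The displacement between two fronts *)

Lemma front_hits (W : R -> R) (v : R) : front W -> a < v < b -> exists y, W y = v.
Proof.
  intros HW Hv.
  destruct (front_near_a W HW (v - a)) as [s Hs]; [lra|].
  destruct (front_near_b W HW (b - v)) as [t Ht]; [lra|].
  assert (Hst : s < t).
  { destruct (Rlt_dec s t) as [|H]; [assumption|].
    assert (W t <= W s) by (apply (front_mono W HW); lra); lra. }
  destruct (IVT_gen W s t v) as [y [_ Hy]].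
  - intros x; apply continuous_continuity_pt, front_continuous, HW.
  - rewrite Rmin_left, Rmax_right by lra; lra.
  - now exists y.
Qed.

Section TwoFronts.

Variables W Wbar : R -> R.
Hypotheses (HW : front W) (HWbar : front Wbar).

Section Displacement.

Variable D : R -> R.
Hypothesis HD : forall x, Wbar (x + D x) = W x.

(** The map [x + D x] is [Wbar^-1] composed with [W]. *)
Lemma displaced_lt (x y : R) : x < y -> x + D x < y + D y.
Proof.
  intros H.
  destruct (Rlt_dec (x + D x) (y + D y)) as [|Hn]; [assumption|].
  assert (Wbar (y + D y) <= Wbar (x + D x)) by (apply (front_mono Wbar HWbar); lra).
  assert (Hi := front_increasing W HW x y H); rewrite !HD in *; lra.
Qed.

Lemma displacement_continuous (x : R) : continuous D x.
Proof.
  apply continuous_eps_delta; intros eps Heps.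
  set (e := eps / 2). assert (He : 0 < e) by (unfold e; lra).
  set (y := x + D x).
  assert (Hlo : Wbar (y - e) < W x)
    by (rewrite <- HD; apply (front_increasing Wbar HWbar); fold y; lra).
  assert (Hhi : W x < Wbar (y + e))
    by (rewrite <- HD; apply (front_increasing Wbar HWbar); fold y; lra).
  destruct (eps_delta_continuous W x (Rmin (W x - Wbar (y - e)) (Wbar (y + e) - W x)))
    as [d [Hd Hz]].
  - apply front_continuous, HW.
  - apply Rmin_glb_lt; lra.
  - exists (Rmin d e); split; [now apply Rmin_glb_lt|].
    intros z Hzx.
    assert (H1 := Rmin_l d e). assert (H2 := Rmin_r d e).
    specialize (Hz z ltac:(lra)).
    assert (H3 := Rmin_l (W x - Wbar (y - e)) (Wbar (y + e) - W x)).
    assert (H4 := Rmin_r (W x - Wbar (y - e)) (Wbar (y + e) - W x)).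
    apply Rabs_lt_between in Hz. apply Rabs_lt_between in Hzx.
    rewrite <- (HD z) in Hz.
    assert (y - e < z + D z).
    { destruct (Rlt_dec (y - e) (z + D z)) as [|Hn]; [assumption|].
      assert (Wbar (z + D z) <= Wbar (y - e)) by (apply (front_mono Wbar HWbar); lra); lra. }
    assert (z + D z < y + e).
    { destruct (Rlt_dec (z + D z) (y + e)) as [|Hn]; [assumption|].
      assert (Wbar (y + e) <= Wbar (z + D z)) by (apply (front_mono Wbar HWbar); lra); lra. }
    apply Rabs_lt_between; unfold y, e in *; lra.
Qed.

(** The point [x + D x] has the headway of [x], so the travel time of [Wbar]
    from there is an integral over the same interval, shifted by [D x]. *)
Lemma displacement_balance (x : R) :
  RInt (fun z => / phi (W z) - / phi (Wbar (z + D x))) x (x + l / W x) = 0.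
Proof.
  assert (Hc : forall z, continuous (fun z => / phi (W z)) z)
    by exact (inv_phi_front_continuous W HW).
  assert (Hcb : forall z, continuous (fun z => / phi (Wbar z)) z)
    by exact (inv_phi_front_continuous Wbar HWbar).
  assert (Hcs : forall z, continuous (fun z => / phi (Wbar (z + D x))) z).
  { intros z; apply (continuous_comp (fun z => z + D x) (fun z => / phi (Wbar z))).
    - apply (continuous_plus (V := R_NormedModule)); [apply continuous_id | apply continuous_const].
    - apply Hcb. }
  assert (E := RInt_minus (V := R_CompleteNormedModule) _ _ x (x + l / W x)
    (ex_RInt_everywhere_continuous _ x (x + l / W x) Hc)
    (ex_RInt_everywhere_continuous _ x (x + l / W x) Hcs)).
  assert (Hshift : RInt (fun z => / phi (Wbar (z + D x))) x (x + l / W x)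
                   = travel Wbar (x + D x)).
  { unfold travel; rewrite HD.
    assert (El := RInt_comp_lin (V := R_CompleteNormedModule) (fun z => / phi (Wbar z)) 1 (D x)
      x (x + l / W x) (ex_RInt_everywhere_continuous _ _ _ Hcb)).
    rewrite !Rmult_1_l in El.
    replace (x + D x + l / W x) with (x + l / W x + D x) by ring.
    rewrite <- El.
    apply RInt_ext; intros z _.
    unfold scal; simpl; unfold mult; simpl; rewrite !Rmult_1_l; reflexivity. }
  assert (E' : RInt (fun z => / phi (W z) - / phi (Wbar (z + D x))) x (x + l / W x)
    = travel W x - RInt (fun z => / phi (Wbar (z + D x))) x (x + l / W x)) by exact E.
  assert (HT := travel_value W HW x); unfold travel in HT.
  assert (HTb := travel_value Wbar HWbar (x + D x)).
  unfold travel in E'; lra.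
Qed.

Local Notation r := (exp (- C * (l / a))).

(** The densities [W z = Wbar (z + D z)] and [Wbar (z + D x)] both lie within
    a headway of the density [W x], so their gap to [b] is between [r] times
    [b - W x] and [b - W x].  The slope of [1 / phi (Wbar)] between the two
    points is comparable to that gap. *)
Lemma displacement_kernel_bounds (w1 x z : R) :
  a < w1 < b -> w1 <= W x -> x <= z <= x + l / W x ->
  let F := / phi (W z) - / phi (Wbar (z + D x)) in
  let alpha := c * (a ^ 2 / l * (g w1 - g b)) * r * (b - W x) in
  let beta := K / (phi b) ^ 2 * C * (b - W x) in
  (D x <= D z -> alpha * (D z - D x) <= F <= beta * (D z - D x)) /\
  (D z <= D x -> alpha * (D x - D z) <= - F <= beta * (D x - D z)).
Proof.
  intros Hw1 Hx Hz F alpha beta.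
  assert (HL := headway_bounds W HW x).
  assert (HC := decay_rate_pos).
  assert (Hlt := front_lt_b W HW x).
  assert (Hr : r <= exp (- C * (z - x))).
  { apply exp_le_compat; rewrite <- !Ropp_mult_distr_l.
    apply Ropp_le_contravar, Rmult_le_compat_l; lra. }
  assert (Hr' : r * (b - W x) <= (b - W x) * exp (- C * (z - x))).
  { rewrite Rmult_comm; apply Rmult_le_compat_l; lra. }
  assert (Hgap : r * (b - W x) <= b - W z).
  { eapply Rle_trans; [apply Hr' | apply front_gap_decay; [assumption | lra]]. }
  assert (Hgapbar : r * (b - W x) <= b - Wbar (z + D x)).
  { assert (H := front_gap_decay Wbar HWbar (x + D x) (z + D x) ltac:(lra)).
    rewrite HD in H; replace (z + D x - (x + D x)) with (z - x) in H by ring; lra. }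
  assert (Hlow : W x <= W z) by (apply (front_mono W HW); lra).
  assert (Hlowbar : W x <= Wbar (z + D x))
    by (rewrite <- HD; apply (front_mono Wbar HWbar); lra).
  unfold F; rewrite <- (HD z); split; intros Hle.
  - assert (H := inv_phi_increment_bounds Wbar HWbar w1 (W x) r (z + D x) (z + D z)
      Hw1 Hx ltac:(lra) Hlowbar ltac:(rewrite HD; exact Hgap)).
    replace (z + D z - (z + D x)) with (D z - D x) in H by ring; exact H.
  - assert (H := inv_phi_increment_bounds Wbar HWbar w1 (W x) r (z + D z) (z + D x)
      Hw1 Hx ltac:(lra) ltac:(rewrite HD; exact Hlow) Hgapbar).
    replace (z + D x - (z + D z)) with (D x - D z) in H by ring.
    rewrite Ropp_minus_distr; exact H.
Qed.

(** Over a window of length [l / a] the gap [b - W] keeps the fraction [r].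
    [Wbar] covers the same range of densities at a slope of at least
    [k * r * (b - W x)], hence within the distance [1 / (k * r)]. *)
Lemma displacement_oscillation_bounded (x0 : R) :
  exists B, forall x z, x0 <= x -> x <= z <= x + l / a -> Rabs (D z - D x) <= B.
Proof.
  set (w1 := W x0).
  assert (Hw1 : a < w1 < b)
    by (split; [apply (front_gt_a W HW) | apply (front_lt_b W HW)]).
  set (k := a ^ 2 / l * (g w1 - g b)).
  assert (Hk : 0 < k).
  { apply Rmult_lt_0_compat.
    - apply Rdiv_lt_0_compat; [apply pow_lt; lra | assumption].
    - assert (H := flow_gt_at_ends w1 Hw1); lra. }
  assert (Hr : 0 < r) by apply exp_pos.
  assert (Hkr : 0 < k * r) by now apply Rmult_lt_0_compat.
  exists (l / a + / (k * r)); intros x z Hx Hz.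
  assert (Hpos : 0 < / (k * r)) by now apply Rinv_0_lt_compat.
  assert (Hmove : 0 <= z + D z - (x + D x) <= / (k * r)).
  { assert (Hord : x + D x <= z + D z).
    { destruct (proj1 Hz) as [H|H]; [|subst; lra].
      apply displaced_lt in H; lra. }
    split; [lra|].
    assert (Hgt : w1 <= W x) by (apply (front_mono W HW); exact Hx).
    assert (Hlt := front_lt_b W HW x). assert (Hltz := front_lt_b W HW z).
    assert (HC := decay_rate_pos).
    assert (Hgap : r * (b - W x) <= b - W z).
    { eapply Rle_trans; [|apply front_gap_decay; [assumption | apply Hz]].
      rewrite Rmult_comm; apply Rmult_le_compat_l; [lra|].
      apply exp_le_compat; rewrite <- !Ropp_mult_distr_l.
      apply Ropp_le_contravar, Rmult_le_compat_l; lra. }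
    destruct (front_increment_bounds Wbar HWbar w1 (W x) r (x + D x) (z + D z))
      as [H _]; try assumption.
    - rewrite HD; lra.
    - rewrite HD; exact Hgap.
    - rewrite !HD in H; fold k in H.
      apply Rmult_le_reg_l with (k * r * (b - W x)); [apply Rmult_lt_0_compat; lra|].
      replace (k * r * (b - W x) * / (k * r)) with (b - W x) by (field; lra).
      lra. }
  apply Rabs_le_between; lra.
Qed.

(** The lower slope bound holds on half-lines only, with a constant that
    degenerates at -infinity.  Any two points lie in such a half-line, and the
    Liouville theorem is applied there. *)
Lemma displacement_constant (x y : R) : D x = D y.
Proof.
  set (x0 := Rmin x y). set (w1 := W x0).
  assert (Hw1 : a < w1 < b)
    by (split; [apply (front_gt_a W HW) | apply (front_lt_b W HW)]).
  set (c1 := c * (a ^ 2 / l * (g w1 - g b)) * r).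
  set (C1 := K / (phi b) ^ 2 * C).
  assert (HC1 : 0 < C1).
  { apply Rmult_lt_0_compat; [|apply decay_rate_pos].
    apply Rdiv_lt_0_compat; [apply K_pos | now apply pow_lt]. }
  assert (Hc1 : 0 < c1).
  { apply Rmult_lt_0_compat; [|apply exp_pos].
    apply Rmult_lt_0_compat; [assumption|].
    apply Rmult_lt_0_compat.
    - apply Rdiv_lt_0_compat; [apply pow_lt; lra | assumption].
    - assert (H := flow_gt_at_ends w1 Hw1); lra. }
  assert (Hla : 0 < l / a) by now apply Rdiv_lt_0_compat.
  assert (Hlb : 0 < l / b) by (apply Rdiv_lt_0_compat; lra).
  destruct (displacement_oscillation_bounded x0) as [B HB].
  assert (Hc : forall z, continuous D z) by exact displacement_continuous.
  assert (HF : forall x z, continuous (fun z => / phi (W z) - / phi (Wbar (z + D x))) z).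
  { intros p z; apply (continuous_minus (V := R_NormedModule)).
    - apply (inv_phi_front_continuous W HW).
    - apply (continuous_comp (fun z => z + D p) (fun z => / phi (Wbar z))).
      + apply (continuous_plus (V := R_NormedModule));
          [apply continuous_id | apply continuous_const].
      + apply (inv_phi_front_continuous Wbar HWbar). }
  assert (Hscale : forall p, c1 / ((C1 + c1) * (l / a))
    = c1 * (b - W p) / ((C1 + c1) * (b - W p) * (l / a))).
  { intros p; assert (Hlt := front_lt_b W HW p).
    field; repeat split; apply Rgt_not_eq; lra. }
  assert (Hwin : forall p, 2 * (l / b / 2) <= l / W p <= l / a).
  { intros p; replace (2 * (l / b / 2)) with (l / b) by (field; lra).
    apply (headway_bounds W HW). }
  assert (Hmean : dominates_forward_mean x0 (l / b / 2) (l / a) (c1 / ((C1 + c1) * (l / a))) D).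
  { intros p m Hp Hm.
    assert (Hlt := front_lt_b W HW p).
    assert (Hpos1 : 0 < c1 * (b - W p)) by (apply Rmult_lt_0_compat; lra).
    assert (Hpos2 : 0 < C1 * (b - W p)) by (apply Rmult_lt_0_compat; lra).
    rewrite (Hscale p).
    apply (forward_mean_of_balance D
      (fun z => / phi (W z) - / phi (Wbar (z + D p))) p (l / W p)); try assumption.
    - apply HF.
    - lra.
    - apply Hwin.
    - apply Hwin.
    - lra.
    - apply displacement_balance.
    - intros z Hz.
      destruct (displacement_kernel_bounds w1 p z Hw1
        (front_mono W HW x0 p Hp) Hz) as [H1 H2].
      fold c1 C1 in H1, H2; split; intros Hle.
      + apply H1, Hle.
      + specialize (H2 Hle).
        assert (0 <= c1 * (b - W p) * (D p - D z)) by (apply Rmult_le_pos; lra).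
        lra. }
  assert (Hmean' : dominates_forward_mean x0 (l / b / 2) (l / a) (c1 / ((C1 + c1) * (l / a)))
                     (fun z => - D z)).
  { intros p m Hp Hm.
    assert (Hlt := front_lt_b W HW p).
    assert (Hpos1 : 0 < c1 * (b - W p)) by (apply Rmult_lt_0_compat; lra).
    assert (Hpos2 : 0 < C1 * (b - W p)) by (apply Rmult_lt_0_compat; lra).
    rewrite (Hscale p).
    apply (forward_mean_of_balance (fun z => - D z)
      (fun z => - (/ phi (W z) - / phi (Wbar (z + D p)))) p (l / W p)); try assumption.
    - now apply continuous_opp_fun.
    - apply (continuous_opp_fun (fun z => / phi (W z) - / phi (Wbar (z + D p)))), HF.
    - lra.
    - apply Hwin.
    - apply Hwin.
    - lra.
    - assert (E := RInt_opp (V := R_CompleteNormedModule) _ p (p + l / W p)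
        (ex_RInt_everywhere_continuous _ p (p + l / W p) (HF p))).
      assert (E' : RInt (fun z => - (/ phi (W z) - / phi (Wbar (z + D p)))) p (p + l / W p)
        = - RInt (fun z => / phi (W z) - / phi (Wbar (z + D p))) p (p + l / W p)) by exact E.
      assert (Hbal := displacement_balance p); lra.
    - intros z Hz.
      destruct (displacement_kernel_bounds w1 p z Hw1
        (front_mono W HW x0 p Hp) Hz) as [H1 H2].
      fold c1 C1 in H1, H2; split; intros Hle.
      + specialize (H2 ltac:(lra)); lra.
      + specialize (H1 ltac:(lra)).
        assert (0 <= c1 * (b - W p) * (D z - D p)) by (apply Rmult_le_pos; lra).
        lra. }
  apply (forward_mean_liouville x0 (l / b / 2) (l / a) (c1 / ((C1 + c1) * (l / a)))
    ltac:(lra) ltac:(assert (H := Hwin x); lra)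
    ltac:(apply Rdiv_lt_0_compat; [|apply Rmult_lt_0_compat]; lra) D B Hc Hmean Hmean' HB).
  - apply Rmin_l.
  - apply Rmin_r.
Qed.

End Displacement.

Theorem fronts_equal_up_to_shift : exists h, forall x, Wbar x = W (x - h).
Proof.
  assert (Hex : forall x, exists d, Wbar (x + d) = W x).
  { intros x.
    destruct (front_hits Wbar (W x) HWbar) as [y Hy].
    - split; [apply (front_gt_a W HW) | apply (front_lt_b W HW)].
    - exists (y - x); rewrite <- Hy; f_equal; ring. }
  set (D := fun x => proj1_sig (constructive_indefinite_description _ (Hex x))).
  assert (HD : forall x, Wbar (x + D x) = W x)
    by (intros x; exact (proj2_sig (constructive_indefinite_description _ (Hex x)))).
  exists (D 0); intros x.
  rewrite <- (HD (x - D 0)), (displacement_constant D HD (x - D 0) 0).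
  f_equal; ring.
Qed.

End TwoFronts.
End Fronts.

(** * Differentiation relative to the unit interval *)

(** Composing with [clamp] turns a function with one-sided derivatives at the
    ends of the unit interval into one that is continuous on the whole line,
    without changing its derivative inside. *)
Definition clamp (x : R) : R := Rmax 0 (Rmin 1 x).

Lemma clamp_range (x : R) : I01 (clamp x).
Proof.
  unfold I01, clamp; split; [apply Rmax_l|].
  apply Rmax_lub; [lra | apply Rmin_l].
Qed.

Lemma clamp_id (x : R) : I01 x -> clamp x = x.
Proof.
  intros [H0 H1]; unfold clamp.
  rewrite Rmin_right, Rmax_right; lra.
Qed.

Lemma clamp_contracts (x y : R) : Rabs (clamp y - clamp x) <= Rabs (y - x).
Proof.
  unfold clamp, Rmax, Rmin.
  repeat destruct Rle_dec; unfold Rabs; repeat destruct Rcase_abs; lra.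
Qed.

Lemma clamped_continuous (f df : R -> R) :
  derivative_on I01 f df -> forall x, continuous (fun t => f (clamp t)) x.
Proof.
  intros Hf x; apply continuous_eps_delta; intros eps Heps.
  destruct (cont_deriv f df I01 (clamp x) (Hf _ (clamp_range x)) eps Heps) as [d [Hd Hy]].
  exists d; split; [assumption|]; intros y Hyx.
  destruct (Req_dec (clamp y) (clamp x)) as [->|Hne].
  - replace (f (clamp x) - f (clamp x)) with 0 by ring; now rewrite Rabs_R0.
  - apply (Hy (clamp y)); split.
    + split; [apply clamp_range | congruence].
    + eapply Rle_lt_trans; [apply clamp_contracts | assumption].
Qed.

Lemma clamped_derivable (f df : R -> R) (x : R) :
  derivative_on I01 f df -> 0 < x < 1 ->
  derivable_pt_lim (fun t => f (clamp t)) x (df x).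
Proof.
  intros Hf Hx eps Heps.
  destruct (Hf x ltac:(unfold I01; lra) eps Heps) as [d [Hd Hy]].
  assert (Hr : 0 < Rmin d (Rmin x (1 - x))) by (repeat apply Rmin_glb_lt; lra).
  exists (mkposreal _ Hr); intros h Hh0 Hh; simpl in Hh.
  assert (H1 := Rmin_l d (Rmin x (1 - x))). assert (H2 := Rmin_r d (Rmin x (1 - x))).
  assert (H3 := Rmin_l x (1 - x)). assert (H4 := Rmin_r x (1 - x)).
  assert (Hb := Hh); apply Rabs_lt_between in Hb.
  rewrite !clamp_id by (unfold I01; lra).
  assert (H := Hy (x + h)); simpl in H; unfold Rdist in H.
  replace (x + h - x) with h in H by ring.
  apply H; split; [|lra].
  split; [unfold I01; lra | lra].
Qed.

Lemma mean_value_on_unit (f df : R -> R) (s t : R) :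
  derivative_on I01 f df -> 0 <= s -> s < t -> t <= 1 ->
  exists xi, s < xi < t /\ f t - f s = df xi * (t - s).
Proof.
  intros Hf Hs Hst Ht.
  set (F := fun x => f (clamp x)).
  assert (HF : forall x, s < x < t -> derivable_pt F x)
    by (intros x Hx; exists (df x); apply clamped_derivable; [assumption | lra]).
  destruct (MVT F id s t HF (fun x _ => derivable_pt_id x)) as [xi [Hxi E]].
  - assumption.
  - intros x _; apply continuous_continuity_pt, (clamped_continuous f df Hf).
  - intros; apply derivable_continuous_pt, derivable_pt_id.
  - exists xi; split; [assumption|].
    replace (derive_pt F xi (HF xi Hxi)) with (df xi) in E.
    + replace (derive_pt id xi (derivable_pt_id xi)) with 1 in E
        by (symmetry; apply derive_pt_id).
      unfold F, id in E; rewrite !clamp_id in E by (unfold I01; lra); lra.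
    + symmetry; apply derive_pt_eq_0, clamped_derivable; [assumption | lra].
Qed.

Lemma derivative_bounded_below (f df ddf : R -> R) :
  derivative_on I01 df ddf -> exists K, forall x, I01 x -> - K <= df x.
Proof.
  intros Hf.
  destruct (continuous_min _ 0 1 (clamped_continuous df ddf Hf) Rle_0_1) as [q [_ Hq]].
  exists (- df (clamp q)); intros x Hx.
  rewrite Ropp_involutive, <- (clamp_id x Hx); apply Hq, Hx.
Qed.

(** The mean slopes from [u] to [v] and from [v] to [w] are values of the strictly
    decreasing derivative at two points on different sides of [v]. *)
Lemma strictly_concave_chord (f df ddf : R -> R) (c0 : R) :
  derivative_on I01 f df -> derivative_on I01 df ddf ->
  0 < c0 -> (forall x, I01 x -> ddf x <= - c0) ->
  forall u v w, 0 <= u -> u < v -> v < w -> w <= 1 ->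
    (f u - f w) * (w - v) < (f v - f w) * (w - u).
Proof.
  intros Hf Hdf Hc0 Hc u v w Hu Huv Hvw Hw.
  destruct (mean_value_on_unit f df u v Hf) as [x1 [Hx1 E1]]; try lra.
  destruct (mean_value_on_unit f df v w Hf) as [x2 [Hx2 E2]]; try lra.
  destruct (mean_value_on_unit df ddf x1 x2 Hdf) as [x3 [Hx3 E3]]; try lra.
  assert (Hneg : ddf x3 <= - c0) by (apply Hc; unfold I01; lra).
  assert (Hdec : df x2 < df x1).
  { assert (0 < - ddf x3 * (x2 - x1)) by (apply Rmult_lt_0_compat; lra); lra. }
  assert (Hpos : 0 < (df x1 - df x2) * ((v - u) * (w - v)))
    by (repeat apply Rmult_lt_0_compat; lra).
  replace (f u) with (f v - df x1 * (v - u)) by lra.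
  replace (f v) with (f w - df x2 * (w - v)) by lra.
  lra.
Qed.

(** * Monotone profiles *)

Lemma is_lim_m_infty_elim (W : R -> R) (L eps : R) :
  is_lim W m_infty L -> 0 < eps ->
  exists M, forall x, x < M -> Rabs (W x - L) < eps.
Proof.
  intros H Heps; apply is_lim_spec in H.
  destruct (H (mkposreal eps Heps)) as [M HM]; exists M; exact HM.
Qed.

Lemma is_lim_p_infty_elim (W : R -> R) (L eps : R) :
  is_lim W p_infty L -> 0 < eps ->
  exists M, forall x, M < x -> Rabs (W x - L) < eps.
Proof.
  intros H Heps; apply is_lim_spec in H.
  destruct (H (mkposreal eps Heps)) as [M HM]; exists M; exact HM.
Qed.

Lemma increasing_between_limits (W : R -> R) (m p : R) :
  increasing W -> is_lim W m_infty m -> is_lim W p_infty p ->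
  forall x, m <= W x <= p.
Proof.
  intros Hi Hm Hp x; split; apply Rnot_lt_le; intros Hn.
  - destruct (is_lim_m_infty_elim W m (m - W x) Hm) as [M HM]; [lra|].
    assert (HM1 := Rmin_l (M - 1) x). assert (HM2 := Rmin_r (M - 1) x).
    assert (H1 := HM (Rmin (M - 1) x) ltac:(lra)).
    assert (H2 := Hi _ _ HM2).
    apply Rabs_lt_between in H1; lra.
  - destruct (is_lim_p_infty_elim W p (W x - p) Hp) as [M HM]; [lra|].
    assert (HM1 := Rmax_l (M + 1) x). assert (HM2 := Rmax_r (M + 1) x).
    assert (H1 := HM (Rmax (M + 1) x) ltac:(lra)).
    assert (H2 := Hi _ _ HM2).
    apply Rabs_lt_between in H1; lra.
Qed.

Lemma decreasing_between_limits (W : R -> R) (m p : R) :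
  decreasing W -> is_lim W m_infty m -> is_lim W p_infty p ->
  forall x, p <= W x <= m.
Proof.
  intros Hd Hm Hp x.
  assert (H := increasing_between_limits (fun t => - W t) (- m) (- p)).
  assert (- m <= - W x <= - p); [apply H|lra].
  - intros s t Hst; apply Ropp_le_contravar, Hd, Hst.
  - apply (is_lim_opp W m_infty m Hm).
  - apply (is_lim_opp W p_infty p Hp).
Qed.

Lemma profile_constant (l : R) (phi : R -> R) (rho : R) (W : R -> R) :
  monotone_stationary_profile l phi rho rho W -> forall x, W x = rho.
Proof.
  intros [_ [Hi|Hd] _ _ Hm Hp] x.
  - assert (H := increasing_between_limits W rho rho Hi Hm Hp x); lra.
  - assert (H := decreasing_between_limits W rho rho Hd Hm Hp x); lra.
Qed.

(** A decreasing profile is excluded because its limits would be in the wrong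
    order. *)
Lemma profile_front (l a b : R) (phi W : R -> R) :
  0 < a -> a < b -> b < 1 ->
  monotone_stationary_profile l phi a b W -> front l a b phi W.
Proof.
  intros Ha Hab Hb1 [_ Hmono Hdde _ Hm Hp].
  assert (Hi : increasing W).
  { destruct Hmono as [Hi|Hd]; [assumption|].
    assert (H := decreasing_between_limits W a b Hd Hm Hp 0); lra. }
  assert (Hr := increasing_between_limits W a b Hi Hm Hp).
  split.
  - exact Hr.
  - exact Hi.
  - intros x; apply is_derive_Reals.
    assert (H := Hdde ltac:(unfold degenerate; lra) x).
    unfold W_ahead in H; destruct (Req_EM_T (W x) 0) as [H0|_]; [|exact H].
    specialize (Hr x); lra.
  - intros eps Heps; destruct (is_lim_m_infty_elim W a eps Hm Heps) as [M HM].
    exists (M - 1); assert (H := HM (M - 1) ltac:(lra)).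
    apply Rabs_lt_between in H; lra.
  - intros eps Heps; destruct (is_lim_p_infty_elim W b eps Hp Heps) as [M HM].
    exists (M + 1); assert (H := HM (M + 1) ltac:(lra)).
    apply Rabs_lt_between in H; lra.
Qed.

Lemma steps_equal_up_to_shift (W Wbar : R -> R) (s sbar : R) :
  step_at s W -> step_at sbar Wbar ->
  forall x, ~ step_at x Wbar -> Wbar x = W (x - (sbar - s)).
Proof.
  intros [H0 H1] Hbar x Hx.
  destruct (Rtotal_order x sbar) as [H|[->|H]].
  - rewrite (proj1 Hbar x H), H0; lra.
  - contradiction.
  - rewrite (proj2 Hbar x H), H1; lra.
Qed.

Theorem theorem3p2
  (l V : R) (hl : 0 < l) (hV : 0 < V)
  (phi dphi ddphi : R -> R)
  (hdphi : derivative_on I01 phi dphi)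
  (hddphi : derivative_on I01 dphi ddphi)
  (hcphi : continuous_on I01 ddphi)
  (hphi0 : phi 0 = 1) (hphi1 : phi 1 = 0)
  (c0hat : R) (hc0hat : 0 < c0hat)
  (hphidec : forall r : R, I01 r -> dphi r <= - c0hat)
  (df ddf : R -> R)
  (hdf : derivative_on I01 (flux V phi) df)
  (hddf : derivative_on I01 df ddf)
  (c0 : R) (hc0 : 0 < c0)
  (hfconc : forall r : R, I01 r -> ddf r <= - c0)
  (rho_star : R) (hrs : 0 < rho_star < 1)
  (hcrit : df rho_star = 0)
  (hcrit_unique : forall r : R, I01 r -> df r = 0 -> r = rho_star)
  (rho_m rho_p : R)
  (hm0 : 0 <= rho_m) (hms : rho_m <= rho_star)
  (hsp : rho_star <= rho_p) (hp1 : rho_p <= 1)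
  (hflux : flux V phi rho_m = flux V phi rho_p)
  (W Wbar : R -> R)
  (hW : monotone_stationary_profile l phi rho_m rho_p W)
  (hWbar : monotone_stationary_profile l phi rho_m rho_p Wbar) :
  exists h : R, forall x : R,
    (* for unit steps, the value at the jump point is immaterial *)
    ~ (degenerate rho_m rho_p /\ step_at x Wbar) ->
    Wbar x = W (x - h).
Proof.
  assert (Hslope : exists K, forall v w, 0 <= v -> v <= w -> w <= 1 ->
            c0hat * (w - v) <= phi v - phi w <= K * (w - v)).
  { destruct (derivative_bounded_below phi dphi ddphi hddphi) as [K HK].
    exists K; intros v w Hv Hvw Hw.
    destruct Hvw as [Hvw|Hvw]; [|subst; lra].
    destruct (mean_value_on_unit phi dphi v w hdphi Hv Hvw Hw) as [xi [Hxi E]].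
    assert (Hxi01 : I01 xi) by (unfold I01; lra).
    assert (H1 := hphidec xi Hxi01). assert (H2 := HK xi Hxi01).
    replace (phi v - phi w) with (- dphi xi * (w - v)) by lra.
    split; apply Rmult_le_compat_r; lra. }
  destruct Hslope as [K Hslope].
  destruct (classic (degenerate rho_m rho_p)) as [Hdeg|Hnd].
  { destruct (profile_step _ _ _ _ _ hW Hdeg) as [s Hs].
    destruct (profile_step _ _ _ _ _ hWbar Hdeg) as [sbar Hsbar].
    exists (sbar - s); intros x Hx.
    apply steps_equal_up_to_shift; try assumption.
    intros H; apply Hx; split; assumption. }
  (* Equal end states force both profiles to be constant. *)
  destruct (Rle_lt_or_eq_dec rho_m rho_p ltac:(lra)) as [Hlt|Heq].
  2:{ exists 0; intros x _; subst.
      rewrite (profile_constant _ _ _ _ hW), (profile_constant _ _ _ _ hWbar); reflexivity. }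
  assert (Hflow : rho_m * phi rho_m = rho_p * phi rho_p).
  { unfold flux in hflux; apply (Rmult_eq_reg_l V); lra. }
  assert (Hphi_pos : forall w, 0 <= w -> w < 1 -> 0 < phi w).
  { intros w Hw0 Hw1; destruct (Hslope w 1) as [H _]; try lra.
    assert (0 < c0hat * (1 - w)) by (apply Rmult_lt_0_compat; lra); lra. }
  (* By equality of the fluxes, if one end state is extreme then so is the
     other: vacuum behind and a full road ahead, the degenerate case. *)
  assert (Hp1 : rho_p < 1).
  { destruct hp1 as [|Hp]; [assumption|exfalso; apply Hnd; split; [|assumption]].
    rewrite Hp, hphi1, Rmult_0_r in Hflow.
    apply Rmult_integral in Hflow; destruct Hflow as [|H]; [assumption|].
    assert (0 < phi rho_m) by (apply Hphi_pos; lra); lra. }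
  assert (Hpp := Hphi_pos rho_p ltac:(lra) Hp1).
  assert (Hm0 : 0 < rho_m).
  { destruct hm0 as [|Hm]; [assumption|exfalso].
    rewrite <- Hm, Rmult_0_l in Hflow.
    assert (0 < rho_p * phi rho_p) by (apply Rmult_lt_0_compat; lra); lra. }
  destruct (fronts_equal_up_to_shift l rho_m rho_p K c0hat phi) with (W := W) (Wbar := Wbar)
    as [h Hh]; try assumption.
  - intros w Hw; destruct (Hslope 0 w) as [H _]; try lra.
    assert (0 <= c0hat * (w - 0)) by (apply Rmult_le_pos; lra); lra.
  - intros v w Hv Hvw Hw; apply Hslope; lra.
  - intros v w Hv Hvw Hw.
    assert (H := strictly_concave_chord _ _ _ _ hdf hddf hc0 hfconc v w rho_p
      ltac:(lra) Hvw Hw ltac:(lra)).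
    unfold flux in H; apply Rmult_lt_reg_l with V; [assumption | unfold flow; lra].
  - now apply profile_front.
  - now apply profile_front.
  - exists h; intros x _; apply Hh.
Qed.
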